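(* Let $(f_n)_{n\in\mathbb N}$ be a collection of diffeomorphisms in $\mathrm{Diff}^1_+([0,1])$, each different from the identity and without hyperbolic fixed points, and for each $n$ let $I_n$ be a fundamental domain of $f_n$. Assume that for all $i<n$ one of the following holds: $\mathrm{Supp}(f_n)\subset I_i$; or $\mathrm{Supp}(f_i)\subset I_n$; or the interiors of $\mathrm{Supp}(f_n)$ and $\mathrm{Supp}(f_i)$ are disjoint. Then the group $\langle f_n, n\in\mathbb N\rangle$ generated by the $f_n$ is $C^1$-close to the identity.
   Context: $\mathrm{Supp}(f)$ denotes the support of $f$, the closure of $\{x: f(x)\neq x\}$. A fundamental domain of $f$ is a segment with endpoints $x$ and $f(x)$ for some $x$ with $f(x)\neq x$. A diffeomorphism is without hyperbolic fixed points if its derivative equals $1$ at each of its fixed points. A group $G\subset \mathrm{Diff}^1_+([0,1])$ is $C^1$-close to the identity if there is a sequence $h_n\in \mathrm{Diff}^1_+([0,1])$ such that $h_n g h_n^{-1}\to \mathrm{id}$ in the $C^1$-topology for every $g\in G$. *)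

(* Defs.v *)
From Stdlib Require Import Reals Lra.
Open Scope R_scope.

(* Functions are R -> R; only their values on [0,1] matter. *)
Definition in01 (x : R) : Prop := 0 <= x <= 1.

Definition has_deriv01 (f f' : R -> R) : Prop :=
  forall x, in01 x -> forall eps, eps > 0 -> exists delta, delta > 0 /\
    forall y, in01 y -> y <> x -> Rabs (y - x) < delta ->
      Rabs ((f y - f x) / (y - x) - f' x) < eps.

Definition cont01 (g : R -> R) : Prop :=
  forall x, in01 x -> forall eps, eps > 0 -> exists delta, delta > 0 /\
    forall y, in01 y -> Rabs (y - x) < delta -> Rabs (g y - g x) < eps.

(* f is in Diff^1_+([0,1]): fixes 0 and 1, is C^1 on [0,1] with positive
   derivative (hence an orientation-preserving C^1 diffeomorphism of [0,1]). *)
Definition Diff1plus (f : R -> R) : Prop :=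
  f 0 = 0 /\ f 1 = 1 /\
  exists f', has_deriv01 f f' /\ cont01 f' /\ forall x, in01 x -> f' x > 0.

Definition not_id (f : R -> R) : Prop := exists x, in01 x /\ f x <> x.

Definition no_hyperbolic_fixed_points (f : R -> R) : Prop :=
  forall f', has_deriv01 f f' -> forall x, in01 x -> f x = x -> f' x = 1.

Definition Supp (f : R -> R) (x : R) : Prop :=
  forall eps, eps > 0 -> exists y, in01 y /\ Rabs (y - x) < eps /\ f y <> y.

Definition interiorR (S : R -> Prop) (x : R) : Prop :=
  exists eps, eps > 0 /\ forall y, Rabs (y - x) < eps -> S y.

Definition segment (a b : R) (y : R) : Prop := Rmin a b <= y <= Rmax a b.

(* I is a fundamental domain of f, given by a base point x: I = [x, f x] *)
Definition fundamental_domain_at (f : R -> R) (x : R) : Prop :=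
  in01 x /\ f x <> x.

(* The subgroup of Diff^1_+([0,1]) generated by the family f (as a predicate
   on functions R -> R; elements are determined by their values on [0,1]). *)
Inductive gen_group (f : nat -> R -> R) : (R -> R) -> Prop :=
  | gg_gen : forall n, gen_group f (f n)
  | gg_id : gen_group f (fun x => x)
  | gg_comp : forall g h, gen_group f g -> gen_group f h ->
      gen_group f (fun x => g (h x))
  | gg_inv : forall g h, gen_group f g -> Diff1plus h ->
      (forall x, in01 x -> g (h x) = x /\ h (g x) = x) -> gen_group f h.

Definition C1_near_id (phi : R -> R) (eps : R) : Prop :=
  exists d, has_deriv01 phi d /\
    forall x, in01 x -> Rabs (phi x - x) <= eps /\ Rabs (d x - 1) <= eps.

Definition C1_close_to_id (G : (R -> R) -> Prop) : Prop :=
  exists h k : nat -> R -> R,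
    (forall n, Diff1plus (h n) /\ Diff1plus (k n) /\
       forall x, in01 x -> h n (k n x) = x /\ k n (h n x) = x) /\
    forall g, G g -> forall eps, eps > 0 -> exists N, forall n, (n >= N)%nat ->
      C1_near_id (fun x => h n (g (k n x))) eps.

(* Main.v *)
Require Import Defs.
From Stdlib Require Import Reals Lra Lia List Classical IndefiniteDescription.
From Coquelicot Require Import Coquelicot.
Open Scope R_scope.

(** A diffeomorphism [h] with derivative proportional to [exp u] conjugates [f] to a map
    whose derivative at [h x] is [exp (ln (f' x) + u (f x) - u x)], so it suffices to make
    the cocycles [ln f_i'] almost coboundaries with one common continuous [u], for
    finitely many [f_i] at a time. For a single map, the averaged Birkhoff sums of the
    cocycle [phi] are such a [u]: as [phi] vanishes at the fixed points,
    [|phi x| <= e + C |f x - x|], and the displacements along an orbit sum to at most 1.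
    For a finite family, remove a map [f] whose support is maximal, correct [phi] by the
    solution for [f], solve for the remaining maps, and spread the part of that solution
    living in the fundamental domain of [f] along the orbits of [f] with slowly decaying
    weights: this makes it almost [f]-invariant without changing it on the supports of
    the other maps. *)

(** * Clamping, and passing between continuity on [0,1] and on the line *)

Definition clamp (a b x : R) : R := Rmax a (Rmin x b).

Lemma clamp_bounds a b x : a <= b -> a <= clamp a b x <= b.
Proof.
  intros H; unfold clamp; split; [apply Rmax_l|].
  apply Rmax_lub; [exact H|apply Rmin_r].
Qed.

Lemma clamp_in a b x : a <= x <= b -> clamp a b x = x.
Proof. intros H; unfold clamp; rewrite Rmin_left, Rmax_right; lra. Qed.

Lemma clamp_le a b x : a <= b -> x <= a -> clamp a b x = a.
Proof. intros H Hx; unfold clamp; rewrite Rmin_left, Rmax_left; lra. Qed.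

Lemma clamp_ge a b x : a <= b -> b <= x -> clamp a b x = b.
Proof. intros H Hx; unfold clamp; rewrite Rmin_right, Rmax_right; lra. Qed.

Lemma clamp_lipschitz a b x y :
  a <= b -> Rabs (clamp a b y - clamp a b x) <= Rabs (y - x).
Proof.
  intros H; unfold clamp, Rmax, Rmin, Rabs.
  repeat destruct Rle_dec; repeat destruct Rcase_abs; lra.
Qed.

(** Either alternative makes [extend f] strictly increasing below: in the first, [f] grows along the
    clamped points while [x - clamp a b x] does not decrease; in the second, only the latter grows,
    strictly. *)
Lemma clamp_increments a b x y :
  a <= b -> x < y ->
  clamp a b x < clamp a b y /\ clamp a b y - clamp a b x <= y - x \/
  clamp a b x = clamp a b y.
Proof.
  intros H Hxy; unfold clamp, Rmax, Rmin.
  repeat destruct Rle_dec; lra.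
Qed.

Lemma continuity_eps_delta (g : R -> R) :
  (forall x eps, eps > 0 -> exists delta, delta > 0 /\
     forall y, Rabs (y - x) < delta -> Rabs (g y - g x) < eps) ->
  continuity g.
Proof.
  intros H x eps Heps; destruct (H x eps Heps) as [d [Hd Hg]].
  exists d; split; [exact Hd|]; intros y [_ Hy]; exact (Hg y Hy).
Qed.

Lemma continuity_elim (g : R -> R) x eps :
  continuity g -> eps > 0 -> exists delta, delta > 0 /\
     forall y, Rabs (y - x) < delta -> Rabs (g y - g x) < eps.
Proof.
  intros H Heps; destruct (H x eps Heps) as [d [Hd Hg]].
  exists d; split; [exact Hd|]; intros y Hy.
  destruct (Req_dec x y) as [<-|Hne].
  - rewrite Rminus_diag, Rabs_R0; lra.
  - apply Hg; repeat split; assumption.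
Qed.

Lemma continuity_clamp a b : a <= b -> continuity (clamp a b).
Proof.
  intros H; apply continuity_eps_delta; intros x eps Heps; exists eps.
  split; [exact Heps|]; intros y Hy.
  apply Rle_lt_trans with (2 := Hy), clamp_lipschitz, H.
Qed.

Lemma in01_clamp x : in01 (clamp 0 1 x).
Proof. apply clamp_bounds; lra. Qed.

Lemma continuity_clamp01 (g : R -> R) :
  cont01 g -> continuity (fun x => g (clamp 0 1 x)).
Proof.
  intros H; apply continuity_eps_delta; intros x eps Heps.
  destruct (H _ (in01_clamp x) eps Heps) as [d [Hd Hg]].
  exists d; split; [exact Hd|]; intros y Hy; apply Hg; [apply in01_clamp|].
  apply Rle_lt_trans with (2 := Hy), clamp_lipschitz; lra.
Qed.

Lemma continuity_cont01 (g : R -> R) : continuity g -> cont01 g.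
Proof.
  intros H x _ eps Heps; destruct (continuity_elim g x eps H Heps) as [d [Hd Hg]].
  exists d; split; [exact Hd|]; intros y _; apply Hg.
Qed.

Lemma cont01_ext (f g : R -> R) :
  (forall x, in01 x -> f x = g x) -> cont01 f -> cont01 g.
Proof.
  intros E H x Hx eps Heps; destruct (H x Hx eps Heps) as [d [Hd Hf]].
  exists d; split; [exact Hd|]; intros y Hy; rewrite <- !E; auto.
Qed.

(** * Cohomological equations over homeomorphisms of the line *)

Fixpoint birkhoff (F w : R -> R) (n : nat) (x : R) : R :=
  match n with
  | O => 0
  | S n => w x + birkhoff F w n (F x)
  end.

(** The sum of the Birkhoff sums of lengths 1 to [n], that is, the sum over [k < n] of
    [(n - k) * w (F^k x)]. Divided by [n], it carries the linearly decaying weights [1 - k/n]. *)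
Fixpoint transfer (F w : R -> R) (n : nat) (x : R) : R :=
  match n with
  | O => 0
  | S n => transfer F w n x + birkhoff F w (S n) x
  end.

Lemma continuity_birkhoff F w n :
  continuity F -> continuity w -> continuity (birkhoff F w n).
Proof.
  intros HF Hw; induction n as [|n IH].
  - apply continuity_const; intros x y; reflexivity.
  - apply (continuity_plus w (fun x => birkhoff F w n (F x))); [exact Hw|].
    exact (continuity_comp F _ HF IH).
Qed.

Lemma continuity_transfer F w n :
  continuity F -> continuity w -> continuity (transfer F w n).
Proof.
  intros HF Hw; induction n as [|n IH].
  - apply continuity_const; intros x y; reflexivity.
  - apply (continuity_plus (transfer F w n) (birkhoff F w (S n)) IH).
    apply continuity_birkhoff; assumption.
Qed.

(** Writing S_j for the Birkhoff sums, S_j(F x) = S_{j+1}(x) - w x, so the sum over j of S_j(F x) -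
    S_j(x) telescopes. *)
Lemma transfer_coboundary F w n x :
  transfer F w n (F x) - transfer F w n x = birkhoff F w n (F x) - INR n * w x.
Proof.
  induction n as [|n IH]; [simpl; ring|].
  rewrite S_INR; cbn [transfer birkhoff] in *; lra.
Qed.

Lemma birkhoff_invariant_zero F w (P : R -> Prop) n x :
  (forall y, P y -> P (F y)) -> (forall y, P y -> w y = 0) -> P x ->
  birkhoff F w n x = 0.
Proof.
  intros HP Hw; revert x; induction n as [|n IH]; intros x Hx; [reflexivity|].
  cbn; rewrite Hw, IH; auto; ring.
Qed.

(** After one step the orbit stays where [w] vanishes, so only the term [k = 0] survives, with
    weight [n]. *)
Lemma transfer_absorbed F w (P : R -> Prop) n x :
  (forall y, P y -> P (F y)) -> (forall y, P y -> w y = 0) -> P (F x) ->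
  transfer F w n x = INR n * w x.
Proof.
  intros HP Hw Hx; induction n as [|n IH]; [cbn; ring|].
  rewrite S_INR; cbn [transfer birkhoff].
  rewrite IH, (birkhoff_invariant_zero F w P); auto; ring.
Qed.

(** The drops of the potential [p] along the orbit telescope, and its final value is nonnegative. *)
Lemma birkhoff_bound F w (P : R -> Prop) (p : R -> R) e n x :
  (forall y, P y -> P (F y)) -> (forall y, P y -> 0 <= p y) ->
  (forall y, P y -> Rabs (w y) <= e + (p y - p (F y))) -> P x ->
  Rabs (birkhoff F w n x) <= INR n * e + p x.
Proof.
  intros HP Hp Hw; revert x; induction n as [|n IH]; intros x Hx.
  - cbn; rewrite Rabs_R0; specialize (Hp x Hx); lra.
  - rewrite S_INR; cbn [birkhoff].
    specialize (IH _ (HP x Hx)); specialize (Hw x Hx).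
    pose proof (Rabs_triang (w x) (birkhoff F w n (F x))); lra.
Qed.

(** * Increasing homeomorphisms of the line *)

Definition increasing_inverses (F G : R -> R) : Prop :=
  (forall x y, x < y -> F x < F y) /\ (forall x y, x < y -> G x < G y) /\
  (forall x, F (G x) = x) /\ (forall x, G (F x) = x).

Lemma increasing_inverses_sym F G :
  increasing_inverses F G -> increasing_inverses G F.
Proof. unfold increasing_inverses; tauto. Qed.

Lemma increasing_inverses_continuity F G :
  increasing_inverses F G -> continuity F.
Proof.
  intros [HF [HG [HFG HGF]]]; apply continuity_eps_delta; intros x eps Heps.
  pose proof (HG (F x - eps) (F x) ltac:(lra)) as H1.
  pose proof (HG (F x) (F x + eps) ltac:(lra)) as H2.
  rewrite HGF in H1, H2.
  exists (Rmin (x - G (F x - eps)) (G (F x + eps) - x)).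
  split; [apply Rmin_pos; lra|]; intros y Hy.
  pose proof (Rmin_l (x - G (F x - eps)) (G (F x + eps) - x)).
  pose proof (Rmin_r (x - G (F x - eps)) (G (F x + eps) - x)).
  apply Rabs_def2 in Hy.
  pose proof (HF (G (F x - eps)) y ltac:(lra)) as H3.
  pose proof (HF y (G (F x + eps)) ltac:(lra)) as H4.
  rewrite HFG in H3, H4; apply Rabs_def1; lra.
Qed.

Lemma increasing_le F : (forall x y : R, x < y -> F x < F y) ->
  forall x y, x <= y -> F x <= F y.
Proof.
  intros H x y [Hxy| ->]; [left; auto|right; reflexivity].
Qed.

Lemma increasing_inverses_inj F G x y :
  increasing_inverses F G -> F x = F y -> x = y.
Proof. intros [_ [_ [_ H]]] E; rewrite <- (H x), E, H; reflexivity. Qed.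

Lemma archimed_div M eps : eps > 0 -> 0 <= M ->
  exists m : nat, 0 < INR m /\ M / INR m <= eps.
Proof.
  intros He HM.
  destruct (INR_unbounded (M / eps)) as [m Hm].
  assert (0 <= M / eps) by (apply Rdiv_le_0_compat; lra).
  exists m; split; [lra|].
  apply Rmult_le_reg_r with (INR m); [lra|].
  replace (M / INR m * INR m) with (M / eps * eps) by (field; lra).
  rewrite (Rmult_comm eps); apply Rmult_le_compat_r; lra.
Qed.

Lemma bounded_of_support (w : R -> R) a b : a <= b ->
  continuity w -> (forall x, x <= a \/ b <= x -> w x = 0) ->
  exists M, 0 <= M /\ forall x, Rabs (w x) <= M.
Proof.
  intros Hab Hw H0.
  destruct (continuity_ab_maj (fun x => Rabs (w x)) a b Hab) as [m [Hm _]].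
  { intros c _; apply (continuity_comp w Rabs Hw Rcontinuity_abs). }
  exists (Rabs (w m)); split; [apply Rabs_pos|]; intros x.
  destruct (Rle_dec x a); [|destruct (Rle_dec b x)].
  1,2: rewrite H0 by lra; rewrite Rabs_R0; apply Rabs_pos.
  apply (Hm x); lra.
Qed.

(** * Almost coboundaries over a single map *)

Lemma displacement_bound F phi e :
  continuity F -> continuity phi -> e > 0 ->
  (forall x, x <= 0 \/ 1 <= x -> F x = x) -> (forall x, F x = x -> phi x = 0) ->
  exists C, 0 <= C /\ forall x, Rabs (phi x) <= e + C * Rabs (F x - x).
Proof.
  intros HF Hphi He Hoff H0.
  destruct (bounded_of_support phi 0 1) as [M [HM Hb]]; auto; [lra|].
  (* [theta] is continuous and positive: where the displacement is zero, [phi] is zero and the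
     second summand is [e]. It therefore has a positive minimum on [0,1]. Where [|phi| > e] it
     equals the displacement, so [C] can be the bound of [|phi|] divided by that minimum. *)
  set (theta := fun x => Rabs (F x - x) + Rmax 0 (e - Rabs (phi x))).
  assert (Hc : continuity theta).
  { apply (continuity_plus (fun x => Rabs (F x - x)) (fun x => Rmax 0 (e - Rabs (phi x)))).
    - apply (continuity_comp (fun x => F x - x) Rabs); [|exact Rcontinuity_abs].
      apply (continuity_minus F (fun x => x) HF), derivable_continuous, derivable_id.
    - apply continuity_eps_delta; intros x eps Heps.
      destruct (continuity_elim phi x eps Hphi Heps) as [d [Hd Hp]].
      exists d; split; [exact Hd|]; intros y Hy; specialize (Hp y Hy).
      pose proof (Rabs_triang_inv2 (phi y) (phi x)).
      revert H; unfold Rmax; generalize (Rabs (phi x)) (Rabs (phi y)); intros a b Hab.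
      assert (Hab' : Rabs (b - a) < eps) by lra; apply Rabs_def2 in Hab'.
      repeat destruct Rle_dec; apply Rabs_def1; lra. }
  destruct (continuity_ab_min theta 0 1 ltac:(lra)) as [m [Hm _]].
  { intros c _; apply Hc. }
  assert (Hpos : 0 < theta m).
  { unfold theta; pose proof (Rmax_l 0 (e - Rabs (phi m))).
    pose proof (Rmax_r 0 (e - Rabs (phi m))).
    destruct (Req_dec (F m) m) as [E|E].
    - rewrite (H0 m E), Rabs_R0 in *; pose proof (Rabs_pos (F m - m)); lra.
    - pose proof (Rabs_pos_lt (F m - m) ltac:(lra)); lra. }
  exists (M / theta m); split; [apply Rdiv_le_0_compat; lra|]; intros x.
  assert (0 <= M / theta m) by (apply Rdiv_le_0_compat; lra).
  pose proof (Rabs_pos (F x - x)).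
  assert (0 <= M / theta m * Rabs (F x - x)) by (apply Rmult_le_pos; lra).
  destruct (Rle_dec (Rabs (phi x)) e) as [Hl|Hl]; [lra|].
  destruct (Req_dec (F x) x) as [E|E].
  { rewrite (H0 x E), Rabs_R0 in *; lra. }
  assert (0 <= x <= 1).
  { destruct (Rle_dec 0 x), (Rle_dec x 1); try lra; exfalso; apply E, Hoff; lra. }
  specialize (Hm x H3); unfold theta at 2 in Hm.
  rewrite Rmax_left in Hm by lra.
  assert (M = M / theta m * theta m) by (field; lra).
  assert (M / theta m * theta m <= M / theta m * Rabs (F x - x))
    by (apply Rmult_le_compat_l; lra).
  specialize (Hb x); lra.
Qed.

Definition transfer_mean (F w : R -> R) (m : nat) (x : R) : R := transfer F w m x / INR m.

Lemma continuity_transfer_mean F w m :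
  continuity F -> continuity w -> continuity (transfer_mean F w m).
Proof.
  intros HF Hw.
  apply (continuity_mult (transfer F w m) (fun _ => / INR m)).
  - apply continuity_transfer; assumption.
  - apply continuity_const; intros x y; reflexivity.
Qed.

(** The error left after correcting [w] is a Birkhoff average, so it is small as soon as the
    Birkhoff sums are bounded by a small multiple of [m] plus a constant. *)
Lemma transfer_mean_coboundary F w m x : 0 < INR m ->
  w x + transfer_mean F w m (F x) - transfer_mean F w m x =
  birkhoff F w m (F x) / INR m.
Proof.
  intros Hm; unfold transfer_mean.
  replace (birkhoff F w m (F x)) with
    (transfer F w m (F x) - transfer F w m x + INR m * w x)
    by (rewrite transfer_coboundary; ring).
  field; lra.
Qed.

Lemma transfer_mean_absorbed F w (P : R -> Prop) m x : 0 < INR m ->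
  (forall y, P y -> P (F y)) -> (forall y, P y -> w y = 0) -> P (F x) ->
  transfer_mean F w m x = w x.
Proof.
  intros Hm HP Hw Hx; unfold transfer_mean.
  rewrite (transfer_absorbed F w P); auto; field; lra.
Qed.

Lemma almost_coboundary F G phi eps :
  increasing_inverses F G -> (forall x, x <= 0 \/ 1 <= x -> F x = x) ->
  continuity phi -> (forall x, F x = x -> phi x = 0) -> eps > 0 ->
  exists u, continuity u /\ (forall x, F x = x -> u x = 0) /\
    forall x, Rabs (phi x + u (F x) - u x) <= eps.
Proof.
  intros HFG Hoff Hphi H0 Heps.
  pose proof (increasing_inverses_continuity F G HFG) as HF.
  destruct (displacement_bound F phi (eps / 2)) as [C [HC Hb]]; auto; [lra|].
  destruct (archimed_div C (eps / 2)) as [m [Hm HCm]]; [lra|exact HC|].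
  exists (transfer_mean F phi m).
  assert (Hfix : forall x, F x = x -> transfer_mean F phi m x = 0).
  { intros x Hx; rewrite (transfer_mean_absorbed F phi (fun y => F y = y)); auto.
    - intros y Hy; rewrite Hy; exact Hy.
    - rewrite Hx; exact Hx. }
  split; [apply continuity_transfer_mean; assumption|split; [exact Hfix|]].
  intros x; destruct (Req_dec (F x) x) as [E|E].
  { rewrite E, H0, Hfix by exact E; rewrite Rplus_0_l, Rminus_diag, Rabs_R0; lra. }
  rewrite transfer_mean_coboundary by exact Hm.
  pose proof (increasing_le F (proj1 HFG)) as Hle.
  assert (Hx : 0 <= x <= 1).
  { destruct (Rle_dec 0 x), (Rle_dec x 1); try lra; exfalso; apply E, Hoff; lra. }
  assert (H1 : forall y, 0 <= y <= 1 -> 0 <= F y <= 1).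
  { intros y Hy; rewrite <- (Hoff 0), <- (Hoff 1) by lra; split; apply Hle; lra. }
  (* Orbits are monotone in [0,1], so [C * |F y - y|] is the drop of the potential [C * (1 - y)] for
     an orbit moving right and of [C * y] for one moving left. Both potentials are at most [C]. *)
  assert (HS : Rabs (birkhoff F phi m (F x)) <= INR m * (eps / 2) + C).
  { destruct (Rle_dec x (F x)) as [Hlt|Hlt].
    - apply Rle_trans with (INR m * (eps / 2) + C * (1 - F x)).
      + apply (birkhoff_bound F phi (fun y => 0 <= y <= 1 /\ y <= F y)
                 (fun y => C * (1 - y))).
        * intros y [Hy Hy']; auto.
        * intros y [Hy Hy']; apply Rmult_le_pos; lra.
        * intros y [Hy Hy']; specialize (Hb y); rewrite (Rabs_pos_eq (F y - y)) in Hb; lra.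
        * auto.
      + specialize (H1 x Hx).
        assert (C * (1 - F x) <= C * 1) by (apply Rmult_le_compat_l; lra); lra.
    - apply Rle_trans with (INR m * (eps / 2) + C * F x).
      + apply (birkhoff_bound F phi (fun y => 0 <= y <= 1 /\ F y <= y)
                 (fun y => C * y)).
        * intros y [Hy Hy']; auto.
        * intros y [Hy Hy']; apply Rmult_le_pos; lra.
        * intros y [Hy Hy']; specialize (Hb y).
          rewrite (Rabs_minus_sym (F y)), (Rabs_pos_eq (y - F y)) in Hb; lra.
        * split; [auto|]; apply Hle; lra.
      + specialize (H1 x Hx).
        assert (C * F x <= C * 1) by (apply Rmult_le_compat_l; lra); lra. }
  unfold Rdiv; rewrite Rabs_mult, (Rabs_pos_eq (/ INR m))
    by (left; apply Rinv_0_lt_compat, Hm).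
  apply Rle_trans with ((INR m * (eps / 2) + C) * / INR m).
  { apply Rmult_le_compat_r; [left; apply Rinv_0_lt_compat, Hm|exact HS]. }
  replace ((INR m * (eps / 2) + C) * / INR m) with (eps / 2 + C / INR m) by (field; lra).
  lra.
Qed.

(** * Spreading a function along the translates of a fundamental domain *)

Lemma birkhoff_wandering_bound F w a b M n x :
  (forall y z, y < z -> F y < F z) -> b <= F a -> (forall y, b <= y -> b <= F y) ->
  (forall y, y <= a \/ b <= y -> w y = 0) ->
  0 <= M -> (forall y, Rabs (w y) <= M) -> Rabs (birkhoff F w n x) <= M.
Proof.
  intros HF Hab Hinv H0 HM Hb; revert x.
  induction n as [|n IH]; intros x; [cbn; rewrite Rabs_R0; exact HM|].
  (* An orbit meets the interval between [a] and [b] at most once: from a point beyond [a] it jumps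
     to or past [b], and never returns. At most one term of the sum is nonzero. *)
  cbn; destruct (Rle_dec x a) as [Hx|Hx].
  - rewrite H0, Rplus_0_l by lra; apply IH.
  - rewrite (birkhoff_invariant_zero F w (fun y => b <= y)); auto.
    + rewrite Rplus_0_r; apply Hb.
    + specialize (HF a x ltac:(lra)); lra.
Qed.

Lemma birkhoff_wandering_bound_left F w a b M n x :
  (forall y z, y < z -> F y < F z) -> F b <= a -> (forall y, y <= a -> F y <= a) ->
  (forall y, y <= a \/ b <= y -> w y = 0) ->
  0 <= M -> (forall y, Rabs (w y) <= M) -> Rabs (birkhoff F w n x) <= M.
Proof.
  intros HF Hab Hinv H0 HM Hb; revert x.
  induction n as [|n IH]; intros x; [cbn; rewrite Rabs_R0; exact HM|].
  cbn; destruct (Rle_dec b x) as [Hx|Hx].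
  - rewrite H0, Rplus_0_l by lra; apply IH.
  - rewrite (birkhoff_invariant_zero F w (fun y => y <= a)); auto.
    + rewrite Rplus_0_r; apply Hb.
    + specialize (HF x b ltac:(lra)); lra.
Qed.

(* On the translate [F^k [a, F a]] of the fundamental domain, the function built here
   is [(1 - |k|/m)^+] times the transported [w]. *)
Lemma spread_increasing F G w a eps :
  increasing_inverses F G -> a < F a -> continuity w ->
  (forall x, x <= a \/ F a <= x -> w x = 0) -> eps > 0 ->
  exists v, continuity v /\ (forall x, a <= x <= F a -> v x = w x) /\
    (forall x, F x = x -> v x = 0) /\ forall x, Rabs (v (F x) - v x) <= eps.
Proof.
  intros HFG Ha Hw H0 Heps.
  pose proof (increasing_inverses_continuity F G HFG) as cF.
  pose proof (increasing_inverses_continuity G F (increasing_inverses_sym _ _ HFG)) as cG.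
  destruct HFG as [HF [HG [EFG EGF]]].
  pose proof (increasing_le F HF) as HFle; pose proof (increasing_le G HG) as HGle.
  destruct (bounded_of_support w a (F a)) as [M [HM Hb]]; auto; [lra|].
  destruct (archimed_div (2 * M) eps) as [m [Hm Hme]]; [lra|lra|].
  assert (iF : forall y, F a <= y -> F a <= F y)
    by (intros y Hy; apply HFle; lra).
  assert (iG : forall y, y <= a -> G y <= a).
  { intros y Hy; rewrite <- (EGF a); apply HGle; lra. }
  assert (Hfix : forall x, F x = x -> w x = 0).
  { intros x Hx; apply H0; destruct (Rle_dec x a) as [|Hn]; [left; lra|right].
    specialize (HF a x ltac:(lra)); lra. }
  (* The forward and backward means both contain the term [w x] with weight 1; it is subtracted
     once. *)
  exists (fun x => transfer_mean F w m x + transfer_mean G w m x - w x).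
  repeat split.
  - apply (continuity_minus (fun x => transfer_mean F w m x + transfer_mean G w m x) w); auto.
    apply (continuity_plus (transfer_mean F w m) (transfer_mean G w m));
      apply continuity_transfer_mean; assumption.
  - intros x Hx.
    rewrite (transfer_mean_absorbed F w (fun y => F a <= y)); auto; [|apply HFle; lra].
    rewrite (transfer_mean_absorbed G w (fun y => y <= a)); auto; [lra|].
    rewrite <- (EGF a); apply HGle; lra.
  - intros x Hx.
    assert (Hx' : G x = x) by (rewrite <- Hx at 1; apply EGF).
    rewrite (transfer_mean_absorbed F w (fun y => y = x)); auto.
    rewrite (transfer_mean_absorbed G w (fun y => y = x)); auto.
    + rewrite Hfix; auto; ring.
    + intros y ->; exact Hx'.
    + intros y ->; auto.
    + intros y ->; exact Hx.
    + intros y ->; auto.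
  - intros x.
    (* The identity for [G] is taken at [F x], which [G] sends back to [x]. All terms in [w] then
       cancel, leaving the difference of two Birkhoff sums divided by [m]. Each sum is at most [M],
       whence the [2 * M] in the choice of [m]. *)
    pose proof (transfer_mean_coboundary F w m x Hm) as E1.
    pose proof (transfer_mean_coboundary G w m (F x) Hm) as E2.
    rewrite EGF in E2.
    replace (transfer_mean F w m (F x) + transfer_mean G w m (F x) - w (F x) -
      (transfer_mean F w m x + transfer_mean G w m x - w x)) with
      (birkhoff F w m (F x) / INR m - birkhoff G w m x / INR m) by lra.
    assert (B1 : Rabs (birkhoff F w m (F x)) <= M).
    { apply (birkhoff_wandering_bound F w a (F a)); auto; lra. }
    assert (B2 : Rabs (birkhoff G w m x) <= M).
    { apply (birkhoff_wandering_bound_left G w a (F a)); auto; rewrite EGF; lra. }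
    replace (birkhoff F w m (F x) / INR m - birkhoff G w m x / INR m) with
      ((birkhoff F w m (F x) - birkhoff G w m x) * / INR m) by (field; lra).
    pose proof (Rinv_0_lt_compat _ Hm).
    rewrite Rabs_mult, (Rabs_pos_eq (/ INR m)) by lra.
    apply Rle_trans with (2 := Hme); apply Rmult_le_compat_r; [lra|].
    pose proof (Rabs_triang (birkhoff F w m (F x)) (- birkhoff G w m x)).
    rewrite Rabs_Ropp in H1; unfold Rminus; lra.
Qed.

(** If [F] moves [a] to the left, the segment is the fundamental domain of [G] starting at [F a],
    and almost invariance under [G] is the same as under [F]. *)
Lemma spread F G w a eps :
  increasing_inverses F G -> F a <> a -> continuity w ->
  (forall x, x <= Rmin a (F a) \/ Rmax a (F a) <= x -> w x = 0) -> eps > 0 ->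
  exists v, continuity v /\ (forall x, segment a (F a) x -> v x = w x) /\
    (forall x, F x = x -> v x = 0) /\ forall x, Rabs (v (F x) - v x) <= eps.
Proof.
  intros HFG Ha Hw H0 Heps; unfold segment.
  destruct (Rlt_dec a (F a)) as [Hlt|Hlt].
  - rewrite Rmin_left, Rmax_right in * by lra.
    apply (spread_increasing F G); auto.
  - rewrite Rmin_right, Rmax_left in * by lra.
    pose proof HFG as [_ [_ [EFG EGF]]].
    destruct (spread_increasing G F w (F a) eps) as [v [cv [Hv [Hf Hi]]]];
      rewrite ?EGF; auto using increasing_inverses_sym; [lra|].
    rewrite EGF in Hv; exists v; repeat split; auto.
    + intros x Hx; apply Hf; rewrite <- Hx at 1; apply EGF.
    + intros x; rewrite Rabs_minus_sym; specialize (Hi (F x)); rewrite EGF in Hi.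
      exact Hi.
Qed.

(** No orbit jumps over a fixed point: if [a < x = F x], then [F a < x], and symmetrically. *)
Lemma segment_moved F G a x :
  increasing_inverses F G -> F a <> a -> segment a (F a) x -> F x <> x.
Proof.
  unfold segment; intros HFG Ha Hx E.
  pose proof HFG as [HF _].
  assert (x <> a) by (intros ->; auto).
  assert (x <> F a).
  { intros ->; apply Ha, (increasing_inverses_inj F G) with (1 := HFG), E. }
  destruct (Rlt_dec a (F a)).
  - rewrite Rmin_left, Rmax_right in Hx by lra.
    specialize (HF a x ltac:(lra)); lra.
  - rewrite Rmin_right, Rmax_left in Hx by lra.
    specialize (HF x a ltac:(lra)); lra.
Qed.

(** * Finite families with nested or disjoint supports *)

Definition supported_in (F : R -> R) (A : R -> Prop) : Prop :=
  forall x, F x <> x -> A x.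

Lemma moved_image F G x : increasing_inverses F G -> F x <> x -> F (F x) <> F x.
Proof. intros HFG H E; apply H, (increasing_inverses_inj F G); auto. Qed.

(** Induction on the length of [l], with [phi] arbitrary because it is corrected before the
    recursive call. The vanishing of [u] at common fixed points serves the induction: it allows the
    solution for the remaining maps to be cut off at the ends of a fundamental domain. *)
Lemma finite_family_almost_coboundary (F G : nat -> R -> R) (a : nat -> R) :
  (forall i, increasing_inverses (F i) (G i)) ->
  (forall i x, x <= 0 \/ 1 <= x -> F i x = x) ->
  (forall i, F i (a i) <> a i) ->
  (forall i j, i <> j ->
     supported_in (F i) (segment (a j) (F j (a j))) \/
     supported_in (F j) (segment (a i) (F i (a i))) \/
     forall x, F i x <> x -> F j x = x) ->
  forall (l : list nat) (phi : nat -> R -> R) eps, eps > 0 ->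
  (forall i, continuity (phi i)) -> (forall i x, F i x = x -> phi i x = 0) ->
  exists u, continuity u /\ (forall x, (forall i, In i l -> F i x = x) -> u x = 0) /\
    forall i x, In i l -> Rabs (phi i x + u (F i x) - u x) <= eps.
Proof.
  intros HFG Hoff Ha Hpos.
  set (below := fun i j => supported_in (F i) (segment (a j) (F j (a j)))).
  (* Points of the fundamental domain of [F j] are moved by [F j], so the inclusions chain. *)
  assert (below_trans : forall i j k, below i j -> below j k -> below i k).
  { intros i j k Hij Hjk x Hx; apply Hjk.
    apply (segment_moved _ (G j)) with (a := a j); auto. }
  (* The second image of [a i] is a moved point beyond the fundamental domain. *)
  assert (below_irrefl : forall i, ~ below i i).
  { intros i Hi.
    pose proof (moved_image _ _ _ (HFG i) (Ha i)) as H1.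
    pose proof (moved_image _ _ _ (HFG i) H1) as H2.
    pose proof (Hi _ H1) as S1; pose proof (Hi _ H2) as S2.
    pose proof (HFG i) as [HF _].
    unfold segment in S1, S2.
    destruct (Rlt_dec (a i) (F i (a i))).
    - rewrite Rmin_left, Rmax_right in * by lra.
      pose proof (HF _ _ r) as H3; pose proof (HF _ _ H3); lra.
    - specialize (Ha i); rewrite Rmin_right, Rmax_left in * by lra.
      pose proof (HF (F i (a i)) (a i) ltac:(lra)) as H3; pose proof (HF _ _ H3); lra. }
  assert (maximal : forall l, l <> nil ->
     exists i, In i l /\ forall j, In j l -> ~ below i j).
  { induction l as [|i l IH]; [congruence|intros _].
    destruct l as [|j l].
    { exists i; split; [left; reflexivity|]; intros j [<-|[]]; apply below_irrefl. }
    destruct IH as [t [Ht Hmax]]; [congruence|].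
    destruct (classic (below t i)) as [Hti|Hti].
    - exists i; split; [left; reflexivity|]; intros k [<-|Hk]; [apply below_irrefl|].
      intros H; exact (Hmax k Hk (below_trans _ _ _ Hti H)).
    - exists t; split; [right; exact Ht|]; intros k [<-|Hk]; auto. }
  intros l; remember (length l) as N eqn:EN; revert l EN.
  induction N as [N IHN] using (well_founded_induction Wf_nat.lt_wf).
  intros l EN phi eps Heps cphi phi0.
  destruct l as [|i0 l0].
  { exists (fun _ => 0); split; [apply continuity_const; intros x y; reflexivity|].
    split; [reflexivity|intros i x []]. }
  destruct (maximal (i0 :: l0)) as [t [Ht Hmax]]; [congruence|].
  set (l := i0 :: l0) in *; set (l' := remove Nat.eq_dec t l).
  assert (Hl' : forall i, In i l' -> In i l /\ i <> t)
    by (intros i Hi; apply in_remove in Hi; exact Hi).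
  assert (Hl : forall i, In i l -> i = t \/ In i l').
  { intros i Hi; destruct (Nat.eq_dec i t) as [E|E]; [left; exact E|right].
    apply in_in_remove; auto. }
  assert (Hlow : forall i, In i l' ->
     below i t \/ forall x, F i x <> x -> F t x = x).
  { intros i Hi; destruct (Hl' i Hi) as [Hil Hne].
    destruct (Hpos i t Hne) as [H|[H|H]]; [left; exact H| |right; exact H].
    exfalso; exact (Hmax i Hil H). }
  pose proof (increasing_inverses_continuity _ _ (HFG t)) as cF.
  destruct (almost_coboundary (F t) (G t) (phi t) (eps / 2)) as [u0 [cu0 [u0z Hu0]]];
    auto; [lra|].
  (* The corrected cocycles still vanish at fixed points, and solving them by [u1] means that
     [u0 + u1] solves the original ones for the maps in [l']. *)
  destruct (IHN (length l')) with (l := l') (eps := eps / 2)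
    (phi := fun i x => phi i x + u0 (F i x) - u0 x) as [u1 [cu1 [u1z Hu1]]]; auto.
  { rewrite EN; apply remove_length_lt; exact Ht. }
  { lra. }
  { intros i.
    apply (continuity_minus (fun x => phi i x + u0 (F i x)) u0); auto.
    apply (continuity_plus (phi i) (fun x => u0 (F i x))); auto.
    apply (continuity_comp (F i) u0); auto.
    exact (increasing_inverses_continuity _ _ (HFG i)). }
  { intros i x Hx; rewrite (phi0 i x Hx), Hx; ring. }
  set (lo := Rmin (a t) (F t (a t))); set (hi := Rmax (a t) (F t (a t))).
  assert (Hlohi : lo <= hi) by apply Rminmax.
  (* Every other map fixes both ends. Ends are moved by [F t], which settles disjoint supports. If
     instead [F i] lives in the segment and moved an end [x], then [F i x] and [G i x] would be
     moved too, on opposite sides of [x], so one would lie outside the segment. *)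
  assert (Hends : forall x, (x = lo \/ x = hi) -> u1 x = 0).
  { intros x Hx; apply u1z; intros i Hi.
    destruct (Hlow i Hi) as [H|H]; cycle 1.
    { destruct (Req_dec (F i x) x) as [E|E]; [exact E|].
      exfalso; apply (segment_moved (F t) (G t) (a t) x); auto.
      unfold segment; fold lo hi; destruct Hx as [-> | ->]; lra. }
    destruct (Req_dec (F i x) x) as [E|E]; [exact E|exfalso].
    pose proof (HFG i) as [HF [HG [EFG EGF]]].
    assert (S1 : F i (G i x) <> G i x).
    { rewrite EFG; intros E'; apply E; rewrite E' at 1; apply EFG. }
    apply H in S1; pose proof (H _ (moved_image _ _ _ (HFG i) E)) as S2.
    unfold segment in S1, S2; fold lo hi in S1, S2.
    destruct (Rtotal_order (F i x) x) as [E'|[E'|E']]; [|auto|];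
      pose proof (HG _ _ E') as E2; rewrite EGF in E2; destruct Hx as [-> | ->]; lra. }
  (* As [u1] vanishes at both ends, clamping the argument cuts [u1] off to zero outside the
     fundamental domain without losing continuity. *)
  set (w := fun x => u1 (clamp lo hi x)).
  assert (w_in : forall x, segment (a t) (F t (a t)) x -> w x = u1 x).
  { intros x Hx; unfold w; rewrite clamp_in; auto. }
  assert (w_off : forall x, x <= lo \/ hi <= x -> w x = 0).
  { intros x Hx; unfold w; apply Hends.
    destruct Hx; [left; apply clamp_le|right; apply clamp_ge]; auto. }
  assert (w_out : forall x, ~ segment (a t) (F t (a t)) x -> w x = 0).
  { intros x Hx; apply w_off; unfold segment in Hx; fold lo hi in Hx; lra. }
  destruct (spread (F t) (G t) w (a t) (eps / 2)) as [v [cv [Hv [vz Hvi]]]]; auto.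
  { apply (continuity_comp (clamp lo hi) u1); auto; apply continuity_clamp; auto. }
  { lra. }
  assert (w_fix : forall x, F t x = x -> w x = 0).
  { intros x Hx; apply w_out; intros S.
    exact (segment_moved _ _ _ _ (HFG t) (Ha t) S Hx). }
  (* A point moved by [F t] but outside the segment is fixed by all maps in [l'], so [u1] vanishes
     there. *)
  assert (rest : forall x, F t x <> x -> u1 x = w x).
  { intros x Hx.
    destruct (classic (segment (a t) (F t (a t)) x)) as [S|S].
    - symmetry; auto.
    - rewrite w_out by exact S; apply u1z; intros i Hi.
      destruct (Req_dec (F i x) x) as [E|E]; [exact E|].
      destruct (Hlow i Hi) as [H|H]; exfalso; auto. }
  (* The piece [w] of [u1] is replaced by its spread [v]. Under [F t], [u1 - w] is invariant and [v]
     almost so, leaving the two errors [eps / 2]. Under the other maps [v - w] is invariant, so only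
     [u0 + u1] counts. *)
  exists (fun x => u0 x + (v x + u1 x - w x)); repeat split.
  - apply (continuity_plus u0 (fun x => v x + u1 x - w x)); auto.
    apply (continuity_minus (fun x => v x + u1 x) w).
    + apply (continuity_plus v u1); auto.
    + apply (continuity_comp (clamp lo hi) u1); auto; apply continuity_clamp; auto.
  - intros x Hx; rewrite u0z, vz, w_fix, u1z; auto; [ring|].
    intros i Hi; apply Hx, Hl', Hi.
  - intros i x Hi; destruct (Hl i Hi) as [-> | Hi'].
    + assert (E : u1 (F t x) - w (F t x) = u1 x - w x).
      { destruct (Req_dec (F t x) x) as [E|E]; [rewrite E; reflexivity|].
        rewrite (rest x E), (rest (F t x)); [ring|].
        apply (moved_image _ (G t)); auto. }
      specialize (Hu0 x); specialize (Hvi x).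
      pose proof (Rabs_triang (phi t x + u0 (F t x) - u0 x) (v (F t x) - v x)).
      replace (phi t x + (u0 (F t x) + (v (F t x) + u1 (F t x) - w (F t x))) -
        (u0 x + (v x + u1 x - w x))) with
        (phi t x + u0 (F t x) - u0 x + (v (F t x) - v x)) by lra.
      lra.
    + assert (E : v (F i x) - w (F i x) = v x - w x).
      { destruct (Req_dec (F i x) x) as [E|E]; [rewrite E; reflexivity|].
        pose proof (moved_image _ _ _ (HFG i) E) as E'.
        destruct (Hlow i Hi') as [H|H].
        - rewrite !Hv; auto; lra.
        - rewrite !vz, !w_fix; auto. }
      specialize (Hu1 i x Hi').
      replace (phi i x + (u0 (F i x) + (v (F i x) + u1 (F i x) - w (F i x))) -
        (u0 x + (v x + u1 x - w x))) with
        (phi i x + u0 (F i x) - u0 x + u1 (F i x) - u1 x) by lra.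
      lra.
Qed.

(** * Differential calculus on [[0,1]] *)

(** Gives access to the chain rule and to the continuity of differentiable functions for [D_in]. *)
Lemma has_deriv01_D_in f f' :
  has_deriv01 f f' <-> forall x, in01 x -> D_in f f' in01 x.
Proof.
  split; intros H x Hx eps Heps; destruct (H x Hx eps Heps) as [d [Hd Hf]];
    exists d; (split; [exact Hd|]).
  - intros y [[Hy Hne] Hlt]; apply Hf; auto; apply not_eq_sym, Hne.
  - intros y Hy Hne Hlt; apply Hf; split; [split; [exact Hy|apply not_eq_sym, Hne]|exact Hlt].
Qed.

Lemma has_deriv01_ext f f' g g' :
  (forall x, in01 x -> f x = g x) -> (forall x, in01 x -> f' x = g' x) ->
  has_deriv01 f f' -> has_deriv01 g g'.
Proof.
  intros E E' H x Hx eps Heps; destruct (H x Hx eps Heps) as [d [Hd Hf]].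
  exists d; split; [exact Hd|]; intros y Hy; rewrite <- !E, <- E'; auto.
Qed.

Lemma has_deriv01_comp f f' g g' :
  has_deriv01 f f' -> has_deriv01 g g' -> (forall x, in01 x -> in01 (f x)) ->
  has_deriv01 (fun x => g (f x)) (fun x => f' x * g' (f x)).
Proof.
  rewrite !has_deriv01_D_in; intros Hf Hg H01 x Hx.
  pose proof (Dcomp in01 in01 f' g' f g x (Hf x Hx) (Hg (f x) (H01 x Hx))) as H.
  intros eps Heps; destruct (H eps Heps) as [d [Hd Hc]].
  exists d; split; [exact Hd|]; intros y [[Hy Hne] Hlt]; apply Hc.
  repeat split; auto; apply Hy || apply H01, Hy.
Qed.

Lemma has_deriv01_cont01 f f' : has_deriv01 f f' -> cont01 f.
Proof.
  rewrite has_deriv01_D_in; intros H x Hx eps Heps.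
  destruct (cont_deriv f f' in01 x (H x Hx) eps Heps) as [d [Hd Hc]].
  exists d; split; [exact Hd|]; intros y Hy Hlt.
  destruct (Req_dec x y) as [<-|Hne]; [rewrite Rminus_diag, Rabs_R0; exact Heps|].
  apply Hc; repeat split; auto; apply Hy.
Qed.

(** The difference quotient of [g] is the reciprocal of that of [f] between [g y0] and [g y], and
    [g y] tends to [g y0] by continuity. *)
Lemma has_deriv01_inverse f f' g :
  has_deriv01 f f' -> cont01 g -> (forall y, in01 y -> in01 (g y)) ->
  (forall y, in01 y -> f (g y) = y) -> (forall x, in01 x -> f' x <> 0) ->
  has_deriv01 g (fun y => / f' (g y)).
Proof.
  intros Hf Hg H01 Hfg Hne y0 Hy0.
  pose proof (proj1 (has_deriv01_D_in f f') Hf (g y0) (H01 y0 Hy0)) as HD.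
  assert (Hl : limit1_in g (fun y => in01 y) (g y0) y0).
  { intros eps Heps; destruct (Hg y0 Hy0 eps Heps) as [d [Hd Hc]].
    exists d; split; [exact Hd|]; intros y [Hy Hlt]; apply Hc; auto. }
  pose proof (limit_inv _ _ _ _ (limit_comp _ _ _ _ _ _ _ Hl HD) (Hne _ (H01 _ Hy0))) as Hi.
  intros eps Heps; destruct (Hi eps Heps) as [d [Hd Hc]].
  exists d; split; [exact Hd|]; intros y Hy Hney Hlt.
  assert (Hgne : g y <> g y0).
  { intros E; apply Hney; rewrite <- (Hfg y), <- (Hfg y0), E; auto. }
  specialize (Hc y); cbn in Hc; unfold Rdist in Hc.
  rewrite !Hfg in Hc by auto.
  replace ((g y - g y0) / (y - y0)) with (/ ((y - y0) / (g y - g y0)))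
    by (field; split; lra).
  apply Hc; repeat split; auto; apply Hy || apply H01, Hy.
Qed.

(** Clamping yields a function on the whole line with a two-sided derivative at interior points, as
    the mean value theorem requires. *)
Lemma has_deriv01_interior f f' x : has_deriv01 f f' -> 0 < x < 1 ->
  is_derive (fun y => f (clamp 0 1 y)) x (f' x).
Proof.
  intros H Hx; apply is_derive_Reals; intros eps Heps.
  destruct (H x ltac:(split; lra) eps Heps) as [d [Hd Hf]].
  assert (Hp : 0 < Rmin d (Rmin x (1 - x))) by (repeat apply Rmin_pos; lra).
  exists (mkposreal _ Hp); intros t Ht Hlt; simpl in Hlt.
  pose proof (Rmin_l d (Rmin x (1 - x))); pose proof (Rmin_r d (Rmin x (1 - x))).
  pose proof (Rmin_l x (1 - x)); pose proof (Rmin_r x (1 - x)).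
  assert (Hlt' : Rabs t < Rmin x (1 - x)) by lra; apply Rabs_def2 in Hlt'.
  rewrite !clamp_in by lra.
  specialize (Hf (x + t)); replace (x + t - x) with t in Hf by ring.
  apply Hf; [split; lra|lra|lra].
Qed.

Lemma mean_value01 f f' a b : has_deriv01 f f' -> 0 <= a < b -> b <= 1 ->
  exists c, in01 c /\ f b - f a = f' c * (b - a).
Proof.
  intros H Ha Hb.
  destruct (MVT_gen (fun y => f (clamp 0 1 y)) a b f') as [c [Hc E]].
  - rewrite Rmin_left, Rmax_right by lra; intros x Hx.
    apply has_deriv01_interior; [exact H|lra].
  - intros x _; apply (continuity_clamp01 f (has_deriv01_cont01 _ _ H)).
  - rewrite Rmin_left, Rmax_right in Hc by lra.
    rewrite !clamp_in in E by lra.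
    exists c; split; [split; lra|exact E].
Qed.

(** * Diffeomorphisms of [0,1], their extensions to the line and their inverses *)

Lemma Diff1plus_increasing f a b :
  Diff1plus f -> 0 <= a < b -> b <= 1 -> f a < f b.
Proof.
  intros [_ [_ [f' [Hf [_ Hpos]]]]] Ha Hb.
  destruct (mean_value01 f f' a b Hf Ha Hb) as [c [Hc E]].
  specialize (Hpos c Hc).
  assert (0 < f' c * (b - a)) by (apply Rmult_lt_0_compat; lra); lra.
Qed.

Lemma Diff1plus_in01 f x : Diff1plus f -> in01 x -> in01 (f x).
Proof.
  intros Hf Hx; pose proof Hf as [H0 [H1 _]]; unfold in01 in *.
  assert (0 <= f x).
  { destruct (Req_dec x 0) as [->|]; [lra|].
    pose proof (Diff1plus_increasing f 0 x Hf ltac:(lra) ltac:(lra)); lra. }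
  assert (f x <= 1).
  { destruct (Req_dec x 1) as [->|]; [lra|].
    pose proof (Diff1plus_increasing f x 1 Hf ltac:(lra) ltac:(lra)); lra. }
  lra.
Qed.

Lemma Diff1plus_cont01 f : Diff1plus f -> cont01 f.
Proof. intros [_ [_ [f' [Hf _]]]]; exact (has_deriv01_cont01 f f' Hf). Qed.

(** For [f] fixing 0 and 1 this is [f] continued by the identity, so that the cohomological results
    for homeomorphisms of the line apply. *)
Definition extend (f : R -> R) (x : R) : R := f (clamp 0 1 x) + (x - clamp 0 1 x).

Lemma extend_in01 f x : in01 x -> extend f x = f x.
Proof. intros Hx; unfold extend; rewrite clamp_in by exact Hx; ring. Qed.

Lemma extend_outside f x : Diff1plus f -> x <= 0 \/ 1 <= x -> extend f x = x.
Proof.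
  intros [H0 [H1 _]] [Hx|Hx]; unfold extend.
  - rewrite clamp_le by lra; lra.
  - rewrite clamp_ge by lra; lra.
Qed.

Lemma extend_inverse f : Diff1plus f -> exists G, increasing_inverses (extend f) G.
Proof.
  intros Hf.
  assert (Hinc : forall x y, x < y -> extend f x < extend f y).
  { intros x y Hxy; unfold extend.
    pose proof (in01_clamp x) as [Hx0 Hx1]; pose proof (in01_clamp y) as [Hy0 Hy1].
    destruct (clamp_increments 0 1 x y ltac:(lra) Hxy) as [[Hlt Hle]|E].
    - pose proof (Diff1plus_increasing f _ _ Hf (conj Hx0 Hlt) Hy1); lra.
    - rewrite E; lra. }
  assert (Hcont : continuity (extend f)).
  { apply (continuity_plus (fun x => f (clamp 0 1 x)) (fun x => x - clamp 0 1 x)).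
    - apply continuity_clamp01, Diff1plus_cont01, Hf.
    - apply (continuity_minus (fun x => x) (clamp 0 1)).
      + apply derivable_continuous, derivable_id.
      + apply continuity_clamp; lra. }
  assert (Hsurj : forall y, exists x, extend f x = y).
  { intros y; destruct (Rle_dec y 0); [exists y; apply extend_outside; auto|].
    destruct (Rle_dec 1 y); [exists y; apply extend_outside; auto|].
    destruct (IVT_cor (fun x => extend f x - y) 0 1) as [x [_ Hx]].
    - apply (continuity_minus (extend f) (fun _ => y)); auto.
      apply continuity_const; intros ? ?; reflexivity.
    - lra.
    - rewrite !extend_outside by (auto; lra).
      assert (0 <= (y - 0) * (1 - y)) by (apply Rmult_le_pos; lra); lra.
    - exists x; lra. }
  destruct (functional_choice _ Hsurj) as [G HG].
  assert (HGF : forall x, G (extend f x) = x).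
  { intros x; destruct (Rtotal_order (G (extend f x)) x) as [E|[E|E]]; auto;
      apply Hinc in E; rewrite HG in E; lra. }
  exists G; repeat split; auto.
  intros x y Hxy; destruct (Rtotal_order (G x) (G y)) as [E|[E|E]]; auto.
  - apply (f_equal (extend f)) in E; rewrite !HG in E; lra.
  - apply Hinc in E; rewrite !HG in E; lra.
Qed.

Lemma Diff1plus_inverse f : Diff1plus f ->
  exists g, Diff1plus g /\ forall x, in01 x -> f (g x) = x /\ g (f x) = x.
Proof.
  intros Hf; destruct (extend_inverse f Hf) as [G HG].
  pose proof HG as [HF [HGi [HFG HGF]]].
  assert (G0 : G 0 = 0).
  { rewrite <- (extend_outside f 0 Hf) at 1 by lra; apply HGF. }
  assert (G1 : G 1 = 1).
  { rewrite <- (extend_outside f 1 Hf) at 1 by lra; apply HGF. }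
  assert (G01 : forall y, in01 y -> in01 (G y)).
  { intros y [Hy0 Hy1]; pose proof (increasing_le G HGi) as Hle.
    pose proof (Hle _ _ Hy0); pose proof (Hle _ _ Hy1); unfold in01; lra. }
  assert (Efg : forall y, in01 y -> f (G y) = y).
  { intros y Hy; rewrite <- (HFG y) at 2; rewrite extend_in01; auto. }
  pose proof (increasing_inverses_continuity _ _ (increasing_inverses_sym _ _ HG)) as cG.
  pose proof Hf as [f0 [f1 [f' [Hd [Hc Hpos]]]]].
  exists G; split.
  - repeat split; auto; exists (fun y => / f' (G y)); repeat split.
    + apply has_deriv01_inverse with (f := f); auto.
      * apply continuity_cont01, cG.
      * intros x Hx; specialize (Hpos x Hx); lra.
    + apply cont01_ext with (fun y => / f' (clamp 0 1 (G y))).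
      { intros y Hy; rewrite clamp_in; [reflexivity|apply G01, Hy]. }
      apply continuity_cont01, (continuity_inv (fun y => f' (clamp 0 1 (G y)))).
      * apply (continuity_comp G (fun x => f' (clamp 0 1 x)) cG), continuity_clamp01, Hc.
      * intros y; pose proof (Hpos _ (in01_clamp (G y))); lra.
    + intros y Hy; apply Rinv_0_lt_compat, Hpos, G01, Hy.
  - intros y Hy; split; [auto|].
    rewrite <- (extend_in01 f y Hy); apply HGF.
Qed.

(** * Conjugation by a diffeomorphism of prescribed density *)

Lemma C1_near_id_intro phi d eps : phi 0 = 0 -> has_deriv01 phi d ->
  (forall x, in01 x -> Rabs (d x - 1) <= eps) -> C1_near_id phi eps.
Proof.
  intros H0 Hd He; exists d; split; [exact Hd|]; intros x Hx; split; [|auto].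
  assert (He0 : 0 <= eps) by (apply Rle_trans with (2 := He x Hx), Rabs_pos).
  destruct (Req_dec x 0) as [->|Hne].
  { rewrite H0, Rminus_diag, Rabs_R0; exact He0. }
  unfold in01 in Hx.
  destruct (mean_value01 phi d 0 x Hd ltac:(lra) ltac:(lra)) as [c [Hc E]].
  replace (phi x - x) with ((d c - 1) * x) by lra.
  rewrite Rabs_mult, (Rabs_pos_eq x) by lra.
  specialize (He c Hc); pose proof (Rabs_pos (d c - 1)).
  assert (Rabs (d c - 1) * x <= Rabs (d c - 1) * 1)
    by (apply Rmult_le_compat_l; lra).
  lra.
Qed.

Lemma exp_near_1 t e : Rabs t <= e -> e <= 1 / 2 -> Rabs (exp t - 1) <= 2 * e.
Proof.
  intros Ht He; pose proof (Rabs_pos t) as Hp.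
  apply Rabs_le_between in Ht.
  pose proof (exp_ineq1_le t) as H1; pose proof (exp_ineq1_le (- t)) as H2.
  pose proof (exp_pos t) as H3.
  assert (E : exp t * exp (- t) = 1) by (rewrite <- exp_plus, Rplus_opp_r; apply exp_0).
  assert (exp t * (1 - e) <= 1).
  { rewrite <- E; apply Rmult_le_compat_l; lra. }
  (* Equivalent to [(1 + 2 * e) * (1 - e) >= 1], which turns [exp t * (1 - e) <= 1] into the upper
     bound. *)
  assert (0 <= e * (1 - 2 * e)) by (apply Rmult_le_pos; lra).
  apply Rabs_le; split; [lra|].
  destruct (Rle_dec (exp t) (1 + 2 * e)) as [|Hn]; [lra|].
  assert ((1 + 2 * e) * (1 - e) < exp t * (1 - e))
    by (apply Rmult_lt_compat_r; lra).
  lra.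
Qed.

(** Integrate [exp u] from 0 and normalise by the total mass; the value of [c] is immaterial, as it
    cancels under conjugation. *)
Lemma diffeo_with_density (u : R -> R) : continuity u ->
  exists h c, 0 < c /\ Diff1plus h /\ has_deriv01 h (fun x => c * exp (u x)).
Proof.
  intros Hu.
  assert (cE : continuity (fun x => exp (u x))).
  { apply (continuity_comp u exp Hu), derivable_continuous, derivable_exp. }
  set (h0 := fun x => RInt (fun t => exp (u t)) 0 x).
  assert (Hd : forall x, is_derive h0 x (exp (u x))).
  { intros x; apply (is_derive_RInt (fun t => exp (u t)) h0 0 x).
    - apply filter_forall; intros y; apply (RInt_correct (fun t => exp (u t)) 0 y).
      apply (ex_RInt_continuous (V := R_CompleteNormedModule)); intros z _.
      apply continuity_pt_filterlim, cE.
    - apply continuity_pt_filterlim, cE. }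
  assert (Hpos : 0 < h0 1).
  { apply RInt_gt_0; [lra|intros x _; apply exp_pos|].
    intros x _; apply continuity_pt_filterlim, cE. }
  exists (fun x => / h0 1 * h0 x), (/ h0 1).
  assert (Hder : has_deriv01 (fun x => / h0 1 * h0 x) (fun x => / h0 1 * exp (u x))).
  { intros x _ eps Heps.
    pose proof (is_derive_scal h0 x (/ h0 1) _ (Hd x)) as H.
    apply is_derive_Reals in H; destruct (H eps Heps) as [d Hdd].
    exists d; split; [apply cond_pos|]; intros y _ Hne Hlt.
    specialize (Hdd (y - x) ltac:(lra) Hlt).
    replace (x + (y - x)) with y in Hdd by ring; exact Hdd. }
  pose proof (Rinv_0_lt_compat _ Hpos) as Hinv.
  split; [exact Hinv|split; [|exact Hder]]; repeat split.
  - unfold h0; rewrite RInt_point; apply Rmult_0_r.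
  - apply Rinv_l; lra.
  - exists (fun x => / h0 1 * exp (u x)); repeat split; [exact Hder| |].
    + apply continuity_cont01, (continuity_scal (fun x => exp (u x))), cE.
    + intros x _; apply Rmult_lt_0_compat; [exact Hinv|apply exp_pos].
Qed.

Lemma conjugate_near_id f f' u h k c e :
  Diff1plus f -> has_deriv01 f f' -> (forall x, in01 x -> f' x > 0) ->
  0 < c -> Diff1plus h -> has_deriv01 h (fun x => c * exp (u x)) ->
  Diff1plus k -> (forall x, in01 x -> h (k x) = x) -> e <= 1 / 2 ->
  (forall x, in01 x -> Rabs (ln (f' x) + u (f x) - u x) <= e) ->
  C1_near_id (fun x => h (f (k x))) (2 * e).
Proof.
  intros Hf Hf' Hpos Hc Hh Hh' Hk Ehk He Hu.
  pose proof (fun x => Diff1plus_in01 k x Hk) as k01.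
  pose proof (fun x => Diff1plus_in01 f x Hf) as f01.
  assert (Hne : forall x, c * exp (u x) > 0).
  { intros x; apply Rmult_lt_0_compat; [exact Hc|apply exp_pos]. }
  assert (Hk' : has_deriv01 k (fun y => / (c * exp (u (k y))))).
  { apply (has_deriv01_inverse h (fun x => c * exp (u x))); auto.
    - apply Diff1plus_cont01, Hk.
    - intros x _; specialize (Hne x); lra. }
  pose proof (has_deriv01_comp _ _ _ _ (has_deriv01_comp _ _ _ _ Hk' Hf' k01) Hh'
    (fun x Hx => f01 _ (k01 _ Hx))) as H.
  eapply C1_near_id_intro; [|exact H|].
  - destruct Hf as [f0 _], Hk as [k0 _], Hh as [h0 _].
    rewrite k0, f0; exact h0.
  - intros x Hx; cbn beta; specialize (k01 x Hx); set (z := k x) in *.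
    replace (/ (c * exp (u z)) * f' z * (c * exp (u (f z)))) with
      (exp (ln (f' z) + u (f z) - u z)).
    + apply exp_near_1; auto.
    + unfold Rminus; rewrite !exp_plus, exp_Ropp, exp_ln by (apply Hpos, k01).
      pose proof (exp_pos (u z)); field; split; lra.
Qed.

(** * Supports and moved points *)

Lemma in01_Supp f y : in01 y -> f y <> y -> Supp f y.
Proof.
  intros Hy Hne eps Heps; exists y.
  rewrite Rminus_diag, Rabs_R0; repeat split; auto; apply Hy.
Qed.

(** The displacement is continuous, hence nonzero near [y], and [y] is not 0 or 1 since these are
    fixed. Thus supports with disjoint interiors share no moved point. *)
Lemma moved_interior_Supp f G y : increasing_inverses (extend f) G -> Diff1plus f ->
  in01 y -> f y <> y -> interiorR (Supp f) y.
Proof.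
  intros HG Hf Hy Hne; pose proof Hf as [f0 [f1 _]].
  assert (Hy' : 0 < y < 1).
  { unfold in01 in Hy; destruct (Req_dec y 0) as [->|]; [contradiction|].
    destruct (Req_dec y 1) as [->|]; [contradiction|lra]. }
  pose proof (increasing_inverses_continuity _ _ HG) as cF.
  assert (Hc : continuity (fun x => extend f x - x)).
  { apply (continuity_minus (extend f) (fun x => x)); auto.
    apply derivable_continuous, derivable_id. }
  destruct (continuity_elim _ y (Rabs (extend f y - y)) Hc) as [d [Hd Hn]].
  { apply Rabs_pos_lt; rewrite extend_in01 by exact Hy; lra. }
  exists (Rmin d (Rmin y (1 - y))); split; [repeat apply Rmin_pos; lra|].
  intros z Hz.
  pose proof (Rmin_l d (Rmin y (1 - y))); pose proof (Rmin_r d (Rmin y (1 - y))).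
  pose proof (Rmin_l y (1 - y)); pose proof (Rmin_r y (1 - y)).
  assert (Hz' : Rabs (z - y) < Rmin y (1 - y)) by lra; apply Rabs_def2 in Hz'.
  assert (in01 z) by (split; lra).
  apply in01_Supp; auto; intros E.
  specialize (Hn z ltac:(lra)); cbn in Hn.
  rewrite (extend_in01 f z), E, Rminus_diag, Rminus_0_l, Rabs_Ropp in Hn by auto; lra.
Qed.

Lemma extend_moved f y : Diff1plus f -> extend f y <> y -> in01 y /\ f y <> y.
Proof.
  intros Hf Hne.
  assert (Hy : in01 y).
  { destruct (Rle_dec 0 y), (Rle_dec y 1); try (split; lra);
      exfalso; apply Hne, extend_outside; auto; lra. }
  split; [exact Hy|]; rewrite extend_in01 in Hne; auto.
Qed.

(** * From the generators to the whole group *)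

Lemma C1_near_id_weaken phi e1 e2 : e1 <= e2 -> C1_near_id phi e1 -> C1_near_id phi e2.
Proof.
  intros He [d [Hd H]]; exists d; split; [exact Hd|]; intros x Hx.
  specialize (H x Hx); lra.
Qed.

(** Convergence of the conjugates to the identity survives composition and inversion, under which
    derivatives multiply and invert. Preservation of [0,1] is carried along because [h n] and [k n]
    are mutually inverse only there. *)
Lemma C1_close_gen_group (f h k : nat -> R -> R) :
  (forall n, Diff1plus (f n)) ->
  (forall n, Diff1plus (h n) /\ Diff1plus (k n) /\
     forall x, in01 x -> h n (k n x) = x /\ k n (h n x) = x) ->
  (forall i eps, eps > 0 -> exists N, forall n, (n >= N)%nat ->
     C1_near_id (fun x => h n (f i (k n x))) eps) ->
  forall g, gen_group f g -> (forall x, in01 x -> in01 (g x)) /\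
    forall eps, eps > 0 -> exists N, forall n, (n >= N)%nat ->
      C1_near_id (fun x => h n (g (k n x))) eps.
Proof.
  intros Hf Hhk Hgen g Hg.
  assert (h01 : forall n x, in01 x -> in01 (h n x)).
  { intros n x; apply Diff1plus_in01, Hhk. }
  assert (k01 : forall n x, in01 x -> in01 (k n x)).
  { intros n x; apply Diff1plus_in01, Hhk. }
  induction Hg as [i| |g1 g2 _ [M1 IH1] _ [M2 IH2]|g1 g2 _ [M1 IH1] Hd Hinv].
  - split; [intros x; apply Diff1plus_in01, Hf|apply Hgen].
  - split; [auto|]; intros eps Heps; exists 0%nat; intros n _.
    exists (fun _ => 1); split.
    + apply has_deriv01_ext with (fun x => x) (fun _ => 1); auto.
      * intros x Hx; symmetry; apply Hhk, Hx.
      * intros x _ e He; exists 1; split; [lra|]; intros y _ Hne _.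
        replace ((y - x) / (y - x) - 1) with 0 by (field; lra).
        rewrite Rabs_R0; exact He.
    + intros x Hx; rewrite (proj1 (proj2 (proj2 (Hhk n)) x Hx)).
      rewrite !Rminus_diag, Rabs_R0; lra.
  - split; [auto|]; intros eps Heps.
    (* For derivatives [p], [q] within [e <= 1] of 1, the bound on [p * q - 1] is
       [e * 1 + e + e]. *)
    set (e := Rmin 1 (eps / 3)).
    assert (He : 0 < e <= 1 /\ e <= eps / 3).
    { unfold e; split; [split; [apply Rmin_pos; lra|apply Rmin_l]|apply Rmin_r]. }
    destruct (IH1 e) as [N1 H1]; [lra|]; destruct (IH2 e) as [N2 H2]; [lra|].
    exists (Nat.max N1 N2); intros n Hn.
    destruct (H1 n ltac:(lia)) as [d1 [D1 B1]], (H2 n ltac:(lia)) as [d2 [D2 B2]].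
    assert (M : forall x, in01 x -> in01 (h n (g2 (k n x)))) by auto.
    exists (fun x => d2 x * d1 (h n (g2 (k n x)))); split.
    + apply has_deriv01_ext with (3 := has_deriv01_comp _ _ _ _ D2 D1 M); auto.
      intros x Hx; cbn beta.
      rewrite (proj2 (proj2 (proj2 (Hhk n)) (g2 (k n x)) ltac:(auto))); reflexivity.
    + intros x Hx; specialize (M x Hx).
      specialize (B2 x Hx); specialize (B1 _ M); cbn beta in B1.
      rewrite (proj2 (proj2 (proj2 (Hhk n)) (g2 (k n x)) ltac:(auto))) in B1.
      split.
      * pose proof (Rabs_triang (h n (g1 (g2 (k n x))) - h n (g2 (k n x)))
          (h n (g2 (k n x)) - x)) as T.
        replace (h n (g1 (g2 (k n x))) - h n (g2 (k n x)) + (h n (g2 (k n x)) - x))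
          with (h n (g1 (g2 (k n x))) - x) in T by ring.
        lra.
      * destruct B1 as [_ B1], B2 as [_ B2].
        set (p := d2 x) in *; set (q := d1 (h n (g2 (k n x)))) in *.
        replace (p * q - 1) with ((p - 1) * (q - 1) + ((p - 1) + (q - 1))) by ring.
        pose proof (Rabs_triang ((p - 1) * (q - 1)) ((p - 1) + (q - 1))) as T1.
        pose proof (Rabs_triang (p - 1) (q - 1)) as T2.
        rewrite Rabs_mult in T1.
        assert (Rabs (p - 1) * Rabs (q - 1) <= e * 1)
          by (apply Rmult_le_compat; try apply Rabs_pos; lra).
        lra.
  - assert (M2 : forall x, in01 x -> in01 (g2 x)) by (intros x; apply Diff1plus_in01, Hd).
    split; [exact M2|]; intros eps Heps.
    (* [e <= 1 / 2] keeps the derivative above [1 / 2], so its reciprocal is at most 2 and differs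
       from 1 by at most [2 * e]. *)
    set (e := Rmin (1 / 2) (eps / 2)).
    assert (He : 0 < e <= 1 / 2 /\ e <= eps / 2).
    { unfold e; split; [split; [apply Rmin_pos; lra|apply Rmin_l]|apply Rmin_r]. }
    destruct (IH1 e) as [N H1]; [lra|]; exists N; intros n Hn.
    destruct (H1 n Hn) as [d [D B]].
    set (A := fun x => h n (g1 (k n x))) in *.
    set (C := fun x => h n (g2 (k n x))).
    assert (M : forall x, in01 x -> in01 (C x)) by (unfold C; auto).
    assert (E : forall x, in01 x -> A (C x) = x).
    { intros x Hx; unfold A, C.
      rewrite (proj2 (proj2 (proj2 (Hhk n)) (g2 (k n x)) ltac:(auto))).
      rewrite (proj1 (Hinv (k n x) ltac:(auto))); apply Hhk, Hx. }
    assert (Hd0 : forall x, in01 x -> 1 / 2 <= d x).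
    { intros x Hx; destruct (B x Hx) as [_ B2]; apply Rabs_le_between in B2; lra. }
    assert (cC : cont01 C).
    { destruct (Hhk n) as [[_ [_ [h' [Hh' _]]]] [[_ [_ [k' [Hk' _]]]] _]].
      destruct Hd as [_ [_ [g' [Hg' _]]]].
      refine (has_deriv01_cont01 _ _ (has_deriv01_comp _ _ _ _
        (has_deriv01_comp _ _ _ _ Hk' Hg' _) Hh' _)); auto. }
    exists (fun x => / d (C x)); split.
    + apply (has_deriv01_inverse A d C); auto.
      intros x Hx; specialize (Hd0 x Hx); lra.
    + intros x Hx; specialize (B _ (M x Hx)); specialize (Hd0 _ (M x Hx)).
      change (h n (g1 (k n (C x)))) with (A (C x)) in B.
      rewrite (E x Hx) in B; destruct B as [B1 B2]; split.
      * rewrite Rabs_minus_sym; apply Rle_trans with e; [exact B1|lra].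
      * set (p := d (C x)) in *.
        replace (/ p - 1) with (- (p - 1) * / p) by (field; lra).
        rewrite Rabs_mult, Rabs_Ropp, (Rabs_pos_eq (/ p))
          by (left; apply Rinv_0_lt_compat; lra).
        assert (/ p <= 2).
        { replace 2 with (/ (1 / 2)) by field; apply Rinv_le_contravar; lra. }
        apply Rle_trans with (e * 2); [|lra].
        apply Rmult_le_compat; try lra; [apply Rabs_pos|].
        left; apply Rinv_0_lt_compat; lra.
Qed.

(** * Construction of the conjugating sequence *)

Theorem theoremt2 (f : nat -> R -> R) (x : nat -> R)
  (Hdiff : forall n, Diff1plus (f n))
  (Hnid : forall n, not_id (f n))
  (Hhyp : forall n, no_hyperbolic_fixed_points (f n))
  (Hfund : forall n, fundamental_domain_at (f n) (x n))
  (Hpos : forall i n, (i < n)%nat ->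
     (forall y, Supp (f n) y -> segment (x i) (f i (x i)) y) \/
     (forall y, Supp (f i) y -> segment (x n) (f n (x n)) y) \/
     (forall y, interiorR (Supp (f n)) y -> interiorR (Supp (f i)) y -> False)) :
  C1_close_to_id (gen_group f).
Proof.
  set (F := fun i => extend (f i)).
  assert (HG : forall i, exists G, increasing_inverses (F i) G)
    by (intros i; apply extend_inverse, Hdiff).
  apply functional_choice in HG; destruct HG as [G HG].
  assert (HF' : forall i, exists f', has_deriv01 (f i) f' /\ cont01 f' /\
    forall x, in01 x -> f' x > 0) by (intros i; apply (Hdiff i)).
  apply functional_choice in HF'; destruct HF' as [f' Hf'].
  assert (Hoff : forall i y, y <= 0 \/ 1 <= y -> F i y = y)
    by (intros i y; apply extend_outside, Hdiff).
  assert (Ha : forall i, F i (x i) <> x i).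
  { intros i; destruct (Hfund i) as [H1 H2]; unfold F; rewrite extend_in01; auto. }
  (* The trichotomy is symmetric up to exchanging its first two cases, so it passes from [i < n] to
     all [i <> j]. A common moved point would be interior to both supports, which gives the third
     case. *)
  assert (Hsym : forall i j, i <> j ->
     supported_in (F i) (segment (x j) (F j (x j))) \/
     supported_in (F j) (segment (x i) (F i (x i))) \/
     forall y, F i y <> y -> F j y = y).
  { assert (Hlt : forall i j, (i < j)%nat ->
      supported_in (F j) (segment (x i) (F i (x i))) \/
      supported_in (F i) (segment (x j) (F j (x j))) \/
      forall y, F i y <> y -> F j y <> y -> False).
    { intros i j Hij; unfold F.
      rewrite (extend_in01 (f i) (x i)), (extend_in01 (f j) (x j)) by apply Hfund.
      destruct (Hpos i j Hij) as [H|[H|H]]; [left|right; left|right; right].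
      - intros y Hy; apply extend_moved in Hy; [|apply Hdiff].
        apply H, in01_Supp; apply Hy.
      - intros y Hy; apply extend_moved in Hy; [|apply Hdiff].
        apply H, in01_Supp; apply Hy.
      - intros y Hi Hj; apply extend_moved in Hi, Hj; try apply Hdiff.
        apply (H y); [apply (moved_interior_Supp (f j) (G j))
          |apply (moved_interior_Supp (f i) (G i))]; auto;
          try apply HG; apply Hi || apply Hj. }
    intros i j Hij.
    destruct (Nat.lt_total i j) as [H|[H|H]]; [|contradiction|];
      destruct (Hlt _ _ H) as [L|[L|L]]; auto; right; right; intros y Hy;
      destruct (Req_dec (F j y) y) as [E|E]; auto; exfalso; eauto. }
  set (phi := fun i y => ln (f' i (clamp 0 1 y))).
  assert (cphi : forall i, continuity (phi i)).
  { intros i y; destruct (Hf' i) as [_ [Hc Hp]].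
    apply (continuity_pt_comp (fun y => f' i (clamp 0 1 y)) ln).
    - apply continuity_clamp01, Hc.
    - apply derivable_continuous_pt; eexists.
      apply derivable_pt_lim_ln, Hp, in01_clamp. }
  (* [F i y = y] says that [f i] fixes [clamp 0 1 y], where the derivative is 1 because there are no
     hyperbolic fixed points. *)
  assert (phi0 : forall i y, F i y = y -> phi i y = 0).
  { intros i y Hy; unfold phi.
    replace (f' i (clamp 0 1 y)) with 1; [apply ln_1|symmetry].
    apply (Hhyp i); [apply Hf'|apply in01_clamp|].
    unfold F, extend in Hy; lra. }
  (* Diagonal choice: the [n]-th conjugacy brings [f 0], ..., [f n] within [1 / (n + 1)] of the
     identity. The cocycle error is half of that, to absorb the factor 2 of [conjugate_near_id]. *)
  assert (Hn : forall n : nat, exists hk : (R -> R) * (R -> R),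
    (Diff1plus (fst hk) /\ Diff1plus (snd hk) /\
      forall y, in01 y -> fst hk (snd hk y) = y /\ snd hk (fst hk y) = y) /\
    forall i, (i <= n)%nat ->
      C1_near_id (fun y => fst hk (f i (snd hk y))) (/ (INR n + 1))).
  { intros n.
    pose proof (pos_INR n) as Hn0.
    assert (He : 0 < / (INR n + 1) <= 1).
    { split; [apply Rinv_0_lt_compat; lra|].
      rewrite <- Rinv_1; apply Rinv_le_contravar; lra. }
    destruct (finite_family_almost_coboundary F G x HG Hoff Ha Hsym (seq 0 (S n)) phi
      (/ (INR n + 1) / 2)) as [u [cu [_ Hu]]]; auto; [lra|].
    destruct (diffeo_with_density u cu) as [h [c [Hc [Hh Hh']]]].
    destruct (Diff1plus_inverse h Hh) as [k [Hk Ehk]].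
    exists (h, k); cbn; split; [auto|]; intros i Hi.
    replace (/ (INR n + 1)) with (2 * (/ (INR n + 1) / 2)) by (field; lra).
    destruct (Hf' i) as [Hd [_ Hp]].
    apply conjugate_near_id with (f' := f' i) (u := u) (c := c); auto; [|lra|].
    - intros y Hy; apply Ehk, Hy.
    - intros y Hy; specialize (Hu i y); unfold phi, F in Hu.
      rewrite clamp_in, extend_in01 in Hu by exact Hy.
      apply Hu, in_seq; lia. }
  apply functional_choice in Hn; destruct Hn as [hk Hhk].
  exists (fun n => fst (hk n)), (fun n => snd (hk n)); split; [intros n; apply Hhk|].
  intros g Hg.
  apply (C1_close_gen_group f (fun n => fst (hk n)) (fun n => snd (hk n))); auto.
  - intros n; apply Hhk.
  - intros i eps Heps.
    destruct (archimed_div 1 eps Heps ltac:(lra)) as [m [Hm Hme]].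
    (* [n >= i] puts [f i] among the maps handled at stage [n], and [n >= m] makes the error at most
       [1 / m <= eps]. *)
    exists (Nat.max i m); intros n Hn.
    apply C1_near_id_weaken with (/ (INR n + 1)); [|apply Hhk; lia].
    apply Rle_trans with (2 := Hme); unfold Rdiv; rewrite Rmult_1_l.
    apply Rinv_le_contravar; [exact Hm|].
    pose proof (le_INR m n ltac:(lia)); lra.
Qed.
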